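(* Let $\mathbb{C}$ be an initial configuration on $S$ stacks. Property 8 subsumes Property 4 as a special case: every block subset $\mathbb{B}^4$ of $\mathbb{C}$ that satisfies P4 also satisfies P8.
   Context: Setting (block relocation problem). There are $S$ stacks and $B$ blocks labelled by $\mathbb{B}=\{1,\dots,B\}$; a smaller label means a higher priority (earlier retrieval). The initial configuration $\mathbb{C}$ places every block in exactly one stack, each stack being a finite vertical sequence of blocks. The target block is the block of highest priority. It is assumed that no block is directly retrievable in $\mathbb{C}$ (the target block is not topmost). In a configuration, a block is badly placed (BP) if some block below it in the same stack has a smaller label; otherwise it is well placed (WP). P4: let the target block be in stack $s$. Let $\mathbb{B}^4$ be the union of the set of blocks above the target block in stack $s$ and the set consisting of the block with the highest priority in each of the other $S-1$ stacks that is nonempty. $\mathbb{B}^4$ satisfies P4 if in every experiment in which each block above the target block is relocated exactly once (from top to bottom, each to the top of one of the other $S-1$ stacks, without considering the stack height limit and without moving blocks of other stacks), some relocated block fails to become WP. P8: a block set satisfies P8 if it can be written as $F\cup G$ such that for some block $i$, in a stack $s$ say: $F$ consists of blocks above $i$ in stack $s$ with priorities lower than that of $i$; $G$ consists of at most one WP block (with respect to $\mathbb{C}$) from each of the other $S-1$ stacks, each with priority lower than that of $i$; and, after removing from $\mathbb{C}$ all blocks except those of $F\cup G$, in every experiment in which each block of $F$ is relocated exactly once (from top to bottom, each to the top of one of the other $S-1$ stacks, without considering the stack height limit and without moving blocks of $G$), some relocated block fails to become WP. *)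

(* Defs.v *)
From mathcomp Require Import all_boot.

Set Implicit Arguments.
Unset Strict Implicit.
Unset Printing Implicit Defensive.

(* A block is an element b of 'I_B and carries the label b + 1, so that the
   labels are 1, ..., B; a smaller label means a higher priority. *)
Definition label (B : nat) (b : 'I_B) : nat := b.+1.

(* Each stack is listed from top (head of the sequence) to bottom. *)
Definition config (S B : nat) : Type := {ffun 'I_S -> seq 'I_B}.

Definition above (B : nat) (st : seq 'I_B) (b : 'I_B) : seq 'I_B :=
  take (index b st) st.

Definition below (B : nat) (st : seq 'I_B) (b : 'I_B) : seq 'I_B :=
  drop (index b st).+1 st.

Definition occurs (S B : nat) (C : config S B) (b : 'I_B) : bool :=
  [exists s, b \in C s].

Definition places_every_block_once (S B : nat) (C : config S B) : Prop :=
  forall b : 'I_B, \sum_(s < S) count_mem b (C s) = 1.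

Definition is_target (S B : nat) (C : config S B) (t : 'I_B) : bool :=
  occurs C t && [forall s, all (fun c => label t <= label c) (C s)].

Definition directly_retrievable (S B : nat) (C : config S B) (b : 'I_B) : bool :=
  is_target C b && [exists s, ohead (C s) == Some b].

Definition badly_placed (S B : nat) (C : config S B) (b : 'I_B) : bool :=
  [exists s, (b \in C s) && has (fun c => label c < label b) (below (C s) b)].

Definition well_placed (S B : nat) (C : config S B) (b : 'I_B) : bool :=
  occurs C b && ~~ badly_placed C b.

Definition highest_priority (B : nat) (st : seq 'I_B) (b : 'I_B) : bool :=
  (b \in st) && all (fun c => label b <= label c) st.

(* Moves the top block of stack s to the top of stack d; used for d != s. *)
Definition relocate (S B : nat) (C : config S B) (s d : 'I_S) : config S B :=
  [ffun k => if k == s then behead (C s)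
             else if k == d then take 1 (C s) ++ C k
             else C k].

(* [experiment s bs C C']: C' can be reached from C by relocating the blocks
   of bs, in this order, each being on top of stack s at its turn and going to
   the top of a stack other than s; no other block moves. *)
Inductive experiment (S B : nat) (s : 'I_S) :
    seq 'I_B -> config S B -> config S B -> Prop :=
| experiment_nil (C : config S B) : experiment s [::] C C
| experiment_cons (b : 'I_B) (bs : seq 'I_B) (C C' : config S B) (d : 'I_S) :
    d != s -> ohead (C s) = Some b ->
    experiment s bs (relocate C s d) C' ->
    experiment s (b :: bs) C C'.

(* The filter lists F from top to bottom.  A relocated block is never moved
   again and nothing below it moves, so whether it became well placed can be
   read off in the final configuration. *)
Definition every_experiment_fails (S B : nat) (C : config S B) (s : 'I_S)
    (F : {set 'I_B}) : Prop :=
  forall C' : config S B, experiment s [seq b <- C s | b \in F] C C' ->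
  exists2 b, b \in F & ~~ well_placed C' b.

Definition keep_only (S B : nat) (C : config S B) (A : {set 'I_B}) :
    config S B :=
  [ffun s => [seq b <- C s | b \in A]].

Definition P4 (S B : nat) (C : config S B) (A : {set 'I_B}) : Prop :=
  exists (t : 'I_B) (s : 'I_S),
    [/\ is_target C t, t \in C s,
        A = [set b in above (C s) t] :|:
            [set b | [exists k, (k != s) && highest_priority (C k) b]]
      & every_experiment_fails C s [set b in above (C s) t]].

Definition P8 (S B : nat) (C : config S B) (A : {set 'I_B}) : Prop :=
  exists (i : 'I_B) (s : 'I_S) (F G : {set 'I_B}),
    [/\ A = F :|: G,
        i \in C s,
        forall b, b \in F -> (b \in above (C s) i) /\ label i < label b,
        (forall g, g \in G ->
           [/\ exists2 k, k != s & g \in C k, well_placed C g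
             & label i < label g]) /\
        (forall k, k != s -> #|[set g in G | g \in C k]| <= 1)
      & every_experiment_fails (keep_only C (F :|: G)) s F].

(* Main.v *)
(** Take for [i] the target block, for [F] the blocks above it and for [G] the
    highest-priority blocks of the other stacks.  Every experiment on the
    reduced configuration can be replayed on [C] with the same destinations, so
    that each other stack receives the same blocks in both.  If a relocated
    block fails to become well placed in [C], some smaller block lies below it:
    either a relocated block, also present in the reduced configuration, or an
    original block of the stack, which can be replaced by the highest-priority
    block of that stack, the only block kept there. *)
Require Import Defs.
From mathcomp Require Import all_boot.

Lemma placed_once_stack_inj {S B : nat} {C : config S B} {b : 'I_B} {k l : 'I_S} :
  places_every_block_once C -> b \in C k -> b \in C l -> k = l.
Proof.
move=> placed bk bl; apply/eqP/negPn/negP => neq_kl.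
have := placed b; rewrite (bigD1 k) //= (bigD1 l) /=; last by rewrite eq_sym.
move: bk bl; rewrite -!has_pred1 !has_count.
case: (count_mem b (C k)) => [//|m]; case: (count_mem b (C l)) => [//|n] _ _.
by rewrite !addSn addnS.
Qed.

Lemma placed_once_uniq {S B : nat} {C : config S B} (k : 'I_S) :
  places_every_block_once C -> uniq (C k).
Proof.
move=> placed; apply: count_mem_uniq => b.
have : count_mem b (C k) <= 1 by rewrite -(placed b) (bigD1 k) //= leq_addr.
by rewrite -has_pred1 has_count; case: (count_mem b _) => [|[]].
Qed.

Lemma filter_mem_above {B : nat} {st : seq 'I_B} {b : 'I_B} :
  uniq st -> [seq c <- st | c \in above st b] = above st b.
Proof. by move=> st_uniq; apply/esym/subseq_uniqP/take_subseq. Qed.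

Lemma above_sub {B : nat} {st : seq 'I_B} {b c : 'I_B} :
  c \in above st b -> c \in st.
Proof. exact: mem_take. Qed.

Lemma notin_above {B : nat} (st : seq 'I_B) (b : 'I_B) : b \notin above st b.
Proof. by apply/negP => /index_ltn; rewrite ltnn. Qed.

Lemma target_lt {S B : nat} {C : config S B} {t b : 'I_B} {k : 'I_S} :
  is_target C t -> b \in C k -> b != t -> label t < label b.
Proof.
move=> /andP[_ /forallP/(_ k)/allP min_t] /min_t.
by rewrite /label !ltnS [t <= b]leq_eqVlt eq_sym -val_eqE => /orP[->|].
Qed.

Lemma highest_priority_inj {B : nat} {st : seq 'I_B} {b c : 'I_B} :
  highest_priority st b -> highest_priority st c -> b = c.
Proof.
move=> /andP[b_st /allP min_b] /andP[c_st /allP min_c].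
apply/val_inj/eqP; rewrite eqn_leq -ltnS.
by rewrite (min_b _ c_st) -ltnS (min_c _ b_st).
Qed.

Lemma highest_priority_exists {B : nat} {st : seq 'I_B} {b : 'I_B} :
  b \in st -> exists m, highest_priority st m.
Proof.
move=> b_st; case: (arg_minnP (fun c : 'I_B => label c) b_st) => m m_st min_m.
by exists m; apply/andP; split=> //; apply/allP.
Qed.

Lemma highest_priority_well_placed {S B : nat} {C : config S B} {k : 'I_S} {b : 'I_B} :
  places_every_block_once C -> highest_priority (C k) b -> well_placed C b.
Proof.
move=> placed /andP[b_k /allP min_b]; apply/andP; split.
  by apply/existsP; exists k.
apply/existsPn => l; apply/negP => /andP[b_l /hasP[c c_below lt_cb]].
rewrite -(placed_once_stack_inj placed b_k b_l) in c_below.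
by have := min_b c (mem_drop c_below); rewrite leqNgt lt_cb.
Qed.

Lemma below_cat {B : nat} {st1 : seq 'I_B} (st2 : seq 'I_B) {b : 'I_B} :
  b \in st1 -> below (st1 ++ st2) b = below st1 b ++ st2.
Proof.
move=> b_st1; rewrite /below index_cat b_st1 drop_cat.
case: ltnP => // size_le.
have /eqP idx_eq : (index b st1).+1 == size st1.
  by rewrite eqn_leq size_le index_mem b_st1.
by rewrite idx_eq subnn drop0 drop_size.
Qed.

Lemma relocate_source {S B : nat} {C : config S B} (s d : 'I_S) :
  relocate C s d s = behead (C s).
Proof. by rewrite ffunE eqxx. Qed.

Lemma relocate_other {S B : nat} {C : config S B} {s d k : 'I_S} {b : 'I_B} :
  k != s -> ohead (C s) = Some b ->
  relocate C s d k = (if k == d then [:: b] else [::]) ++ C k.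
Proof.
move=> neq_ks; rewrite ffunE (negPf neq_ks).
by case: (C s) => [//|c r] /= [->]; rewrite take0; case: eqP.
Qed.

(* [X k] is what stack [k] receives, the same in both experiments. *)
Lemma experiment_replay {S B : nat} {s : 'I_S} {bs : seq 'I_B} {D D' : config S B} :
  experiment s bs D D' ->
  forall C : config S B, take (size bs) (C s) = bs ->
  exists (C' : config S B) (X : 'I_S -> seq 'I_B),
    [/\ experiment s bs C C', C' s = drop (size bs) (C s),
        forall k, k != s -> C' k = X k ++ C k /\ D' k = X k ++ D k
      & forall b, b \in bs -> exists2 k, k != s & b \in X k].
Proof.
elim=> {bs D D'} [D C _|b bs D D' d neq_ds top_D _ IH C].
  exists C, (fun=> [::]); split=> //; first exact: experiment_nil.
  by rewrite drop0.
case Cs: (C s) => [//|c r] /= [eq_cb take_r].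
have top_C : ohead (C s) = Some b by rewrite Cs eq_cb.
have source_C : relocate C s d s = r by rewrite relocate_source Cs.
have [|C' [X [expC C's others mem_X]]] := IH (relocate C s d).
  by rewrite source_C.
exists C', (fun k => X k ++ (if k == d then [:: b] else [::])); split.
- exact: experiment_cons neq_ds top_C expC.
- by rewrite C's source_C.
- move=> k neq_ks; have [-> ->] := others k neq_ks.
  by rewrite (relocate_other neq_ks top_C) (relocate_other neq_ks top_D) !catA.
- move=> a; rewrite inE => /predU1P[->|/mem_X[k neq_ks a_X]].
    by exists d; rewrite // eqxx mem_cat mem_head orbT.
  by exists k; rewrite // mem_cat a_X.
Qed.

Lemma every_experiment_fails_keep_only {S B : nat} {C : config S B} {A : {set 'I_B}}
    {s : 'I_S} {t : 'I_B} :
  places_every_block_once C ->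
  (forall b, b \in C s -> (b \in A) = (b \in above (C s) t)) ->
  (forall k b, k != s -> highest_priority (C k) b -> b \in A) ->
  every_experiment_fails C s [set b in above (C s) t] ->
  every_experiment_fails (keep_only C A) s [set b in above (C s) t].
Proof.
move=> placed A_s A_other failsC D'.
have uniq_s := placed_once_uniq s placed.
have filterC : [seq b <- C s | b \in [set c in above (C s) t]] = above (C s) t.
  rewrite -[RHS](filter_mem_above uniq_s).
  by apply: eq_filter => b; rewrite inE.
have filterD : [seq b <- keep_only C A s | b \in [set c in above (C s) t]]
             = above (C s) t.
  rewrite ffunE -filter_predI -[RHS]filterC.
  apply: eq_in_filter => b b_s /=; rewrite A_s // inE andbb //.
rewrite filterD => expD.
have prefix_s : take (size (above (C s) t)) (C s) = above (C s) t.
  by rewrite /above size_takel // index_size.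
have [C' [X [expC C's others mem_X]]] := experiment_replay expD C prefix_s.
have [|b b_F not_wp] := failsC C'; first by rewrite filterC.
exists b => //; rewrite inE in b_F.
have b_s := above_sub b_F.
have C'_occ : occurs C' b.
  have [k neq_ks b_X] := mem_X b b_F.
  by apply/existsP; exists k; rewrite (others k neq_ks).1 mem_cat b_X.
move: not_wp; rewrite /well_placed C'_occ negbK => /existsP[k /andP[b_C'k]].
have neq_ks : k != s.
  apply: contraTneq b_C'k => ->; rewrite C's.
  move: uniq_s; rewrite -{1}(cat_take_drop (size (above (C s) t)) (C s)).
  rewrite prefix_s cat_uniq => /and3P[_ /hasPn disj _].
  by apply/negP => /disj; rewrite /= b_F.
have [eqC' eqD'] := others k neq_ks.
have b_X : b \in X k.
  move: b_C'k; rewrite eqC' mem_cat => /orP[//|b_k].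
  by rewrite (placed_once_stack_inj placed b_k b_s) eqxx in neq_ks.
rewrite eqC' below_cat // => /hasP[c]; rewrite mem_cat => c_below lt_cb.
rewrite negb_and negbK; apply/orP; right.
apply/existsP; exists k; rewrite eqD' mem_cat b_X below_cat //= has_cat.
case/orP: c_below => [c_X|c_k]; first by apply/orP; left; apply/hasP; exists c.
have [m m_min] := highest_priority_exists c_k.
apply/orP; right; apply/hasP; exists m.
  by rewrite ffunE mem_filter (A_other k) //; case/andP: m_min.
by case/andP: m_min => _ /allP/(_ c c_k) /leq_ltn_trans; apply.
Qed.

Theorem corollary3 (S B : nat) (C : config S B)
    (placed : places_every_block_once C)
    (not_retrievable : forall b : 'I_B, ~~ directly_retrievable C b)
    (A : {set 'I_B}) :
  P4 C A -> P8 C A.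
Proof.
move=> [t [s [t_target t_s -> failsC]]].
set F := [set b in _]; set G := [set b | _].
have G_other b : b \in G -> exists2 k, k != s & highest_priority (C k) b.
  by rewrite inE => /existsP[k /andP[]]; exists k.
exists t, s, F, G; split=> //.
- move=> b; rewrite inE => b_above; split=> //.
  apply: (target_lt t_target (above_sub b_above)).
  by apply: contraTneq b_above => ->; apply: notin_above.
- split=> [g /G_other[k neq_ks g_min]|k neq_ks].
    have g_k : g \in C k by case/andP: g_min.
    split; [by exists k | exact: highest_priority_well_placed g_min |].
    apply: (target_lt t_target g_k).
    apply: contraNneq neq_ks => eq_gt; rewrite eq_gt in g_k.
    by rewrite (placed_once_stack_inj placed g_k t_s).
  have min_k g : g \in [set g in G | g \in C k] -> highest_priority (C k) g.
    rewrite !inE => /andP[/existsP[l /andP[_ g_min]] g_k].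
    have g_l : g \in C l by case/andP: g_min.
    by rewrite (placed_once_stack_inj placed g_k g_l).
  apply/card_le1_eqP => g h /min_k g_min /min_k h_min.
  exact: highest_priority_inj h_min g_min.
- apply: every_experiment_fails_keep_only => // [b b_s|k b neq_ks b_min].
    rewrite in_setU [b \in F]inE; case b_G: (b \in G); last by rewrite orbF.
    have [k neq_ks /andP[b_k _]] := G_other b b_G.
    by rewrite (placed_once_stack_inj placed b_k b_s) eqxx in neq_ks.
  by rewrite !inE; apply/orP; right; apply/existsP; exists k; rewrite neq_ks.
Qed.
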